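(* Let $G$ be a max stable df and let $F$ be a df with $\lim_{n\to\infty}F^n(a_nx+b_n)=G(x)$, $x\in\mathbb{R}$, for some $a_n>0$, $b_n\in\mathbb{R}$. Let $X_1,X_2,\dots$ be iid with df $F$, and for each $n$ let $N_n$ be an integer-valued random variable independent of $X_1,X_2,\dots$. (a) Suppose that for some integer $m\ge 1$, $N_n$ is shifted binomial: $P(N_n=r)=\binom{n}{r-m}p_n^{r-m}q_n^{m+n-r}$, $r=m,m+1,\dots,m+n$, where $p_n\in[0,1]$, $q_n=1-p_n$ and $\lim_{n\to\infty}p_n=1$. Then for every fixed integer $k$ with $1\le k\le m$ and every $x$ with $G(x)>0$, $$\lim_{n\to\infty}F_{k:N_n}(a_nx+b_n)=G(x)\sum_{i=0}^{k-1}\frac{(-\ln G(x))^i}{i!}.$$ (b) Suppose that for some integer $m\ge 1$, $N_n$ is shifted Poisson: $P(N_n=r)=\frac{e^{-\lambda_n}\lambda_n^{r-m}}{(r-m)!}$, $r=m,m+1,m+2,\dots$, where $\lambda_n>0$ and $\lim_{n\to\infty}\lambda_n/n=1$. Then for every fixed integer $k$ with $1\le k\le m$ and every $x$ with $G(x)>0$, $$\lim_{n\to\infty}F_{k:N_n}(a_nx+b_n)=G(x)\sum_{i=0}^{k-1}\frac{(-\ln G(x))^i}{i!}.$$ (c) Suppose that $N_n$ is shifted logarithmic: $P(N_n=r)=\frac{1}{-\ln(1-\theta_n)}\frac{\theta_n^{r-n}}{r-n}$, $r=n+1,n+2,\dots$, where $0<\theta_n<1$ and $\lim_{n\to\infty}\frac{\theta_n}{-\ln(1-\theta_n)}=1$.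 Then for every fixed integer $k\ge 1$ and every $x$ with $G(x)>0$, $$\lim_{n\to\infty}F_{k:N_n}(a_nx+b_n)=G(x)\sum_{i=0}^{k-1}\frac{(-\ln G(x))^i}{i!}.$$
   Context: df means distribution function on $\mathbb{R}$. $F_{k:N_n}(x)=P(X_{N_n-k+1:N_n}\le x)=\sum_{r}\sum_{i=0}^{k-1}\binom{r}{i}F^{r-i}(x)(1-F(x))^iP(N_n=r)$ is the df of the $k$-th largest among $X_1,\dots,X_{N_n}$ (in part (c) considered for $n$ large enough that $N_n\ge k$). A max stable df is a df of the form $x\mapsto G_0(Ax+B)$ with $A>0$, $B\in\mathbb{R}$ and $G_0$ one of: $\Phi_\alpha(x)=\exp(-x^{-\alpha})$ for $x>0$ and $0$ for $x\le 0$; $\Psi_\alpha(x)=\exp(-|x|^{\alpha})$ for $x<0$ and $1$ for $x\ge 0$ ($\alpha>0$); $\Lambda(x)=\exp(-e^{-x})$. The convention $0^0=1$ is used. *)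

(* Defs.v *)
From HB Require Import structures.
From mathcomp Require Import all_boot all_order all_algebra.
From mathcomp Require Import finmap.
From mathcomp Require Import all_classical all_reals all_analysis.

Set Implicit Arguments.
Unset Strict Implicit.
Unset Printing Implicit Defensive.

Import Order.TTheory GRing.Theory Num.Theory.
Import numFieldNormedType.Exports.

Local Open Scope classical_set_scope.
Local Open Scope ring_scope.

Section max_stable.
Context {R : realType}.

Definition frechet_df (alpha : R) (x : R) : R :=
  if 0 < x then expR (- (x `^ (- alpha))) else 0.

Definition weibull_df (alpha : R) (x : R) : R :=
  if x < 0 then expR (- (`|x| `^ alpha)) else 1.

Definition gumbel_df (x : R) : R := expR (- expR (- x)).

Definition standard_max_stable (G0 : R -> R) : Prop :=
  [\/ exists2 alpha : R, 0 < alpha & G0 = frechet_df alpha,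
      exists2 alpha : R, 0 < alpha & G0 = weibull_df alpha
    | G0 = gumbel_df].

Definition max_stable (G : R -> R) : Prop :=
  exists (G0 : R -> R) (A B : R),
    [/\ standard_max_stable G0, 0 < A & forall x, G x = G0 (A * x + B)].

End max_stable.

Section random_sample.
Context {d : measure_display} {T : measurableType d} {R : realType}.
Variable P : probability T R.

Definition mutually_independent (X : nat -> {RV P >-> R}) : Prop :=
  forall (J : {fset nat}) (A : nat -> set R),
    (forall i, measurable (A i)) ->
    P (\bigcap_(i in [set` J]) (X i @^-1` A i)) =
    (\prod_(i <- J) P (X i @^-1` A i))%E.

(* The sequence X_1, X_2, ... is stored as X 0, X 1, ...; the cdf of the
   library takes its values in the extended reals. *)
Definition iid_with_df (F : R -> R) (X : nat -> {RV P >-> R}) : Prop :=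
  mutually_independent X /\ forall i x, cdf (X i) x = (F x)%:E.

(* Independence of N from the whole sequence X, i.e. from the sigma-algebra
   generated by all the X i; every subset of nat is measurable. *)
Definition independent_of_sequence
    (N : {RV P >-> nat}) (X : nat -> {RV P >-> R}) : Prop :=
  forall (B : set nat) (E : set T),
    <<s \bigcup_i g_sigma_algebra_preimage (X i) >> E ->
    P (N @^-1` B `&` E) = (P (N @^-1` B) * P E)%E.

(* X_{j:r}, the j-th smallest of the r values X_1, ..., X_r (1 <= j <= r);
   the value is irrelevant when j is out of range. *)
Definition order_statistic (X : nat -> {RV P >-> R}) (j r : nat) (t : T) : R :=
  nth 0 (sort <=%R [seq X i t | i <- iota 0 r]) j.-1.

(* The df of X_{N-k+1:N}, the k-th largest of X_1, ..., X_N; it is meaningful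
   when k <= N almost surely, the subtraction being truncated otherwise. *)
Definition kth_largest_df (X : nat -> {RV P >-> R}) (N : {RV P >-> nat})
    (k : nat) (x : R) : \bar R :=
  P [set t | order_statistic X (N t - k + 1) (N t) t <= x].

End random_sample.

(* Main.v *)
(* The number of exceedances of a level among X_1, ..., X_r grows with r, so the
   event {X_{N-k+1:N} <= y} is squeezed between the same events for the
   deterministic sample sizes (1 - e) n and (1 + e) n as soon as
   (1 - e) n <= N <= (1 + e) n.  For a deterministic size r_n ~ c n the
   probability is a binomial tail, which tends to the Poisson tail of parameter
   - c ln G(x).  In each of the three cases N_n / n tends to 1 in probability;
   letting e tend to 0 and using the continuity of the Poisson tail in c gives
   the limit. *)
Require Import Defs.
From HB Require Import structures.
From mathcomp Require Import all_boot all_order all_algebra.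
From mathcomp Require Import finmap.
From mathcomp Require Import zify ring lra.
From mathcomp Require Import all_classical all_reals all_analysis.

Set Implicit Arguments.
Unset Strict Implicit.
Unset Printing Implicit Defensive.

Import Order.TTheory GRing.Theory Num.Theory.
Import numFieldNormedType.Exports.

Local Open Scope classical_set_scope.
Local Open Scope ring_scope.

(** * Order statistics and exceedance counts *)

(** The entries at most [x] form an initial segment of the sorted sequence; position [j] lies in it
    exactly when it has more than [j] elements, and the other entries are the exceedances. *)
Lemma nth_sort_le (R : realType) (s : seq R) (j : nat) (x : R) :
  (j < size s)%N ->
  (nth 0 (sort <=%R s) j <= x) = (count (fun z => (x < z)%R) s < size s - j)%N.
Proof.
rewrite -(size_sort <=%R) => js.
rewrite -[in RHS](count_sort (<=%R : rel R)).
have ss : sorted <=%R (sort <=%R s) by apply: sort_sorted; exact: le_total.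
move: (sort _ _) ss js => s' ss js.
have -> : count (fun z => (x < z)%R) s' = (size s' - count (fun z => (z <= x)%R) s')%N.
  rewrite -[in RHS](count_predC (fun z => (z <= x)%R) s') addKn.
  by apply: eq_count => z /=; rewrite ltNge.
rewrite ltn_sub2lE ?count_size//.
have [jc|cj] := ltnP j (count (fun z => (z <= x)%R) s').
  exact: (nth_count_le 0 ss jc).
by apply/negbTE; rewrite -ltNge; apply: nth_count_gt => //; rewrite cj.
Qed.

Section exceedances.
Context {d : measure_display} {T : measurableType d} {R : realType}.
Variables (P : probability T R) (X : nat -> {RV P >-> R}).

Definition few_exceedances (k r : nat) (y : R) : set T :=
  [set t | (\sum_(i < r) ((y < X i t)%R) < k)%N].

Lemma few_exceedances_anti (k r r' : nat) (y : R) : (r <= r')%N ->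
  few_exceedances k r' y `<=` few_exceedances k r y.
Proof.
move=> rr' t; rewrite /few_exceedances /=; apply: leq_ltn_trans.
rewrite -!(big_mkord xpredT (fun i => (y < X i t)%R : nat)).
by rewrite [leqRHS](big_cat_nat _ rr')//= leq_addr.
Qed.

(** With [j = r - k + 1] the bound [(r - j).+1] is [k], so the event no longer refers to a rank that
    moves with [r]. *)
Lemma order_statistic_le (j r : nat) (y : R) : (0 < j <= r)%N ->
  [set t | order_statistic X j r t <= y] = few_exceedances (r - j).+1 r y.
Proof.
move=> /andP[j0 jr]; apply/funext => t /=; apply/propext.
rewrite /order_statistic /few_exceedances /= nth_sort_le; last first.
  by rewrite size_map size_iota prednK.
rewrite size_map size_iota count_map -sum1_count big_mkcond /=.
rewrite -(big_mkord xpredT (fun i => (y < X i t)%R : nat)) /index_iota subn0.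
have -> : (r - j.-1 = (r - j).+1)%N by rewrite -subSn// -[j in RHS]prednK.
by rewrite (eq_bigr (fun i => (y < X i t)%R : nat))// => i _; case: ifP.
Qed.

(** Prescribing the exact set of exceeding indices cuts the event of few exceedances into disjoint
    pieces whose probabilities factor by independence. *)
Definition exceedance_pattern (r : nat) (y : R) (J : {set 'I_r}) : set T :=
  [set t | forall i : 'I_r, (y < X i t) = (i \in J)].

(** This is the shape demanded by [mutually_independent]: a finite set of naturals and a family of
    sets indexed by all of [nat], hence the image of [J] under [val]. *)
Lemma exceedance_patternE (I : {fset nat}) (r : nat) (y : R) (J : {set 'I_r}) :
  (forall i, (i \in I) = (i < r)%N) ->
  exceedance_pattern y J =
  \bigcap_(i in [set` I]) X i @^-1`
    (if i \in [seq val j | j in J] then ~` `]-oo, y] else `]-oo, y]%classic).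
Proof.
move=> memI; apply/seteqP; split => t /=.
  move=> Jt i /=; rewrite memI => ir.
  rewrite (_ : (i \in [seq val j | j in J]) = (y < X i t)); last first.
    by rewrite (Jt (Ordinal ir)); exact: (fintype.mem_image val_inj (mem J) (Ordinal ir)).
  case: ifPn => yX /=; rewrite in_itv /=.
    by apply/negP; rewrite -ltNge.
  by rewrite leNgt.
move=> Jt i; have := Jt i; rewrite /= memI ltn_ord => /(_ isT).
rewrite (_ : (val i \in [seq val j | j in J]) = (i \in J)); last first.
  by rewrite fintype.mem_image//; exact: val_inj.
case: ifPn => iJ /=; rewrite in_itv /=.
  by move=> /negP; rewrite -ltNge.
by rewrite leNgt => /negbTE.
Qed.

Let prefix (r : nat) : {I : {fset nat} | forall i, (i \in I) = (i < r)%N}.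
Proof. by exists (seq_fset tt (iota 0 r)) => i; rewrite seq_fsetE mem_iota. Qed.

Lemma measurable_exceedance_pattern (r : nat) (y : R) (J : {set 'I_r}) :
  measurable (exceedance_pattern y J).
Proof.
have [I memI] := prefix r.
rewrite (exceedance_patternE y J memI); apply: fin_bigcap_measurable.
  exact: finite_fset.
move=> i _; apply: measurable_funPTI.
by case: ifP => _; [apply: measurableC|]; exact: measurable_itv.
Qed.

Lemma few_exceedancesE (k r : nat) (y : R) :
  few_exceedances k r y =
  \bigcup_(J in [set J : {set 'I_r} | (#|J| < k)%N]) exceedance_pattern y J.
Proof.
have card (t : T) (J : {set 'I_r}) : exceedance_pattern y J t ->
    (\sum_(i < r) ((y < X i t)%R))%N = #|J|.
  move=> Jt; rewrite -sum1_card [RHS]big_mkcond /=.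
  by apply: eq_bigr => i _; rewrite Jt; case: ifP.
apply/seteqP; split => t.
  rewrite /few_exceedances /= => tk.
  have Jt : exceedance_pattern y [set i : 'I_r | y < X i t]%SET t.
    by move=> i; rewrite inE.
  by exists [set i : 'I_r | y < X i t]%SET => //=; rewrite -(card _ _ Jt).
by move=> [J /= Jk Jt]; rewrite /few_exceedances /= (card _ _ Jt).
Qed.

Lemma measurable_few_exceedances (k r : nat) (y : R) :
  measurable (few_exceedances k r y).
Proof.
rewrite few_exceedancesE; apply: fin_bigcup_measurable.
  exact: finite_finset.
by move=> J _; exact: measurable_exceedance_pattern.
Qed.

Lemma measurable_order_statistic_le (j r : nat) (y : R) : (0 < j)%N ->
  measurable [set t | order_statistic X j r t <= y].
Proof.
move=> j0; have [jr|rj] := leqP j r.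
  by rewrite order_statistic_le ?j0//; exact: measurable_few_exceedances.
(* Out of range, [nth] returns the default [0], so the event is full or empty according to the sign
   of [y]. *)
have [y0|y0] := boolP (0 <= y :> R).
  rewrite (_ : mkset _ = setT)//; apply/seteqP; split => //= t _ /=.
  by rewrite /order_statistic nth_default// size_sort size_map size_iota -ltnS prednK.
rewrite (_ : mkset _ = set0)//; apply/seteqP; split => //= t /=.
rewrite /order_statistic nth_default ?(negbTE y0)//.
by rewrite size_sort size_map size_iota -ltnS prednK.
Qed.

(** Slicing by the value of [N] leaves only deterministic ranks, which makes the event a countable
    union of measurable sets. *)
Lemma kth_largest_event (N : {RV P >-> nat}) (k : nat) (y : R) :
  [set t | order_statistic X (N t - k + 1) (N t) t <= y] =
  \bigcup_r (N @^-1` [set r] `&` [set t | order_statistic X (r - k + 1) r t <= y]).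
Proof.
apply/seteqP; split => t /=; first by exists (N t).
by move=> [r _ [/= ->]].
Qed.

Lemma measurable_kth_largest_event (N : {RV P >-> nat}) (k : nat) (y : R) :
  measurable [set t | order_statistic X (N t - k + 1) (N t) t <= y].
Proof.
rewrite kth_largest_event; apply: bigcup_measurable => r _.
apply: measurableI; last by apply: measurable_order_statistic_le; rewrite addn1.
exact: measurable_funPTI.
Qed.

(** Each pattern has a product probability depending only on its cardinality [i], and there are
    ['C(r, i)] patterns of that cardinality. *)
Lemma prob_few_exceedances (F : R -> R) (hX : iid_with_df F X) (k r : nat) (y : R) :
  P (few_exceedances k r y) =
  (\sum_(i < k) 'C(r, i)%:R * (1 - F y) ^+ i * F y ^+ (r - i))%:E.
Proof.
have PJ (J : {set 'I_r}) : P (exceedance_pattern y J) =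
    ((1 - F y) ^+ #|J| * F y ^+ (r - #|J|))%:E.
  have [ind cdfX] := hX.
  have [I memI] := prefix r.
  rewrite (exceedance_patternE y J memI) ind; last first.
    by move=> i; case: ifP => _; [apply: measurableC|]; exact: measurable_itv.
  have Ple i : P (X i @^-1` `]-oo, y]) = (F y)%:E by exact: cdfX.
  have Pgt i : P (X i @^-1` (~` `]-oo, y])) = (1 - F y)%:E.
    rewrite -[X in P X]/(~` (X i @^-1` `]-oo, y])) probability_setC.
      by rewrite Ple.
    by apply: (measurable_funPTI (X i)); exact: measurable_itv.
  rewrite (perm_big (iota 0 r)) /=; last first.
    by apply: uniq_perm (fset_uniq I) (iota_uniq _ _) _ => i; rewrite memI mem_iota.
  rewrite (eq_bigr (fun i =>
     (if i \in [seq val j | j in J] then 1 - F y else F y)%:E)); last first.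
    by move=> i _; case: ifP => _.
  rewrite prodEFin; congr _%:E.
  rewrite -[X in iota 0 X](subn0 r) -/(index_iota 0 r) big_mkord.
  rewrite (eq_bigr (fun i => if i \in J then 1 - F y else F y)); last first.
    by move=> i _; rewrite fintype.mem_image//; exact: val_inj.
  rewrite (bigID (mem J)) /=; congr (_ * _).
    under eq_bigr => i iJ do rewrite iJ.
    by rewrite prodr_const.
  under eq_bigr => i iJ do rewrite (negbTE iJ).
  rewrite prodr_const; congr (_ ^+ _).
  rewrite -[X in (X - _)%N](card_ord r) -(cardsC J) addKn.
  by apply: eq_card => i; rewrite !inE.
rewrite few_exceedancesE measure_fin_bigcup//; last 3 first.
- exact: finite_finset.
- move=> J J' _ _ [t [/= Jt J't]]; apply/setP => i.
  by rewrite -Jt J't.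
- by move=> J _; exact: measurable_exceedance_pattern.
rewrite -(@bigfs _ _ _ _ (enum {set 'I_r}) (fun J => (#|J| < k)%N)); last 2 first.
- exact: enum_uniq.
- by move=> J _; rewrite mem_enum.
rewrite (eq_bigr (fun J : {set 'I_r} =>
    ((1 - F y) ^+ #|J| * F y ^+ (r - #|J|))%:E)); last first.
  by move=> J _; exact: PJ.
rewrite sumEFin; congr _%:E.
rewrite big_enum_cond/=.
rewrite (eq_bigr (fun i : 'I_k => \sum_(J : {set 'I_r} | #|J| == i)
    (1 - F y) ^+ #|J| * F y ^+ (r - #|J|))); last first.
  move=> i _; rewrite (eq_bigr (fun=> (1 - F y) ^+ i * F y ^+ (r - i))).
    rewrite sumr_const -[X in 'C(X, _)]card_ord -card_draws -mulrA mulr_natl.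
    by congr (_ *+ _); apply: eq_card => J; rewrite inE.
  by move=> J /eqP ->.
(* Patterns are grouped by cardinality through [inord], which needs a nonempty ordinal type; this is
   why [k = 0] is treated apart. *)
case: k => [|k]; first by rewrite big_ord0 big_pred0.
rewrite (partition_big (fun J : {set 'I_r} => inord #|J| : 'I_k.+1) xpredT)//=.
apply: eq_bigr => i _; apply: eq_bigl => J; apply/andP/eqP => [[Jk /eqP <-]|Ji].
  by rewrite inordK.
by rewrite Ji ltn_ord inord_val.
Qed.

End exceedances.

(** * Poisson limit of binomial tails *)

Section poisson_limit.
Variable R : realType.
Implicit Types (c : R) (r : nat -> nat) (f : nat -> R).

Lemma cvgn_inv : (n%:R : R)^-1 @[n --> \oo] --> (0 : R).
Proof.
by apply/gtr0_cvgV0; [near=> n; rewrite ltr0n; near: n; exists 1%N|exact: cvgr_idn].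
Unshelve. all: by end_near. Qed.

Lemma truncn_ratio_cvg c : 0 <= c ->
  (Num.truncn (c * n%:R))%:R / n%:R @[n --> \oo] --> c.
Proof.
move=> c0; apply: (@squeeze_cvgr _ _ _ _ (fun n => c - n%:R^-1) (fun=> c)).
- near=> n.
  have n0 : 0 < n%:R :> R by rewrite ltr0n; near: n; exists 1%N.
  have cn : 0 <= c * n%:R by rewrite mulr_ge0// ltW.
  have /andP[le lt] := truncn_itv cn.
  rewrite ler_pdivrMr// le andbT ler_pdivlMr// mulrBl mulVf ?gt_eqF//.
  by rewrite lerBlDr natr1 ltW.
- by rewrite -[X in _ --> X]subr0; apply: cvgB; [exact: cvg_cst|exact: cvgn_inv].
- exact: cvg_cst.
Unshelve. all: by end_near. Qed.

(** Growth of [r n] at linear speed makes subtractions such as [r n - i] genuine for large [n]. *)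
Lemma ratio_near_ge r c (i : nat) : 0 < c ->
  (r n)%:R / n%:R @[n --> \oo] --> c -> \forall n \near \oo, (i <= r n)%N.
Proof.
move=> c0 rc; near=> n.
have n0 : 0 < n%:R :> R by rewrite ltr0n; near: n; exists 1%N.
have : c / 2 < (r n)%:R / n%:R.
  by near: n; apply: (cvgr_gt c) => //; rewrite ltr_pdivrMr// ltr_pMr// ltr1n.
rewrite ltr_pdivlMr// -(ler_nat R) => /ltW; apply: le_trans.
rewrite -ler_pdivrMl ?divr_gt0//.
near: n; exact: nbhs_infty_ger.
Unshelve. all: by end_near. Qed.

Section limits.
Variables (f : nat -> R) (g : R).
Hypotheses (f01 : forall n, 0 <= f n <= 1) (g0 : 0 < g).
Hypothesis fg : f n ^+ n @[n --> \oo] --> g.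

Let f_gt0 : \forall n \near \oo, 0 < f n.
Proof.
near=> n.
have : 0 < f n ^+ n by near: n; exact: (cvgr_gt g).
have n0 : (0 < n)%N by near: n; exists 1%N.
have /andP[f0 _] := f01 n.
by rewrite lt0r expf_eq0 n0 /= => /andP[fn _]; rewrite lt0r fn f0.
Unshelve. all: by end_near. Qed.

Let cvg_nln : n%:R * ln (f n) @[n --> \oo] --> ln g.
Proof.
have : ln (f n ^+ n) @[n --> \oo] --> ln g.
  by apply: continuous_cvg => //; exact: continuous_ln.
apply: cvg_trans; apply: near_eq_cvg; near=> n.
by rewrite lnXn ?mulr_natl//; near: n.
Unshelve. all: by end_near. Qed.

Let cvg_f1 : f n @[n --> \oo] --> (1 : R).
Proof.
have h : expR (n%:R^-1 * (n%:R * ln (f n))) @[n --> \oo] --> (1 : R).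
  rewrite -[X in _ --> X]expR0 -(mul0r (ln g)).
  by apply: continuous_cvg; [exact: continuous_expR|exact: cvgM cvgn_inv cvg_nln].
apply: cvg_trans h; apply: near_eq_cvg; near=> n.
have n0 : n%:R != 0 :> R by rewrite pnatr_eq0 -lt0n; near: n; exists 1%N.
by rewrite mulKf// lnK// posrE; near: n.
Unshelve. all: by end_near. Qed.

(** The inequality [ln t <= t - 1], taken at [t = f n] and at its inverse, squeezes the sequence
    between [- n ln (f n)] and the same quantity times [f n], which tends to 1. *)
Let cvg_n1f : n%:R * (1 - f n) @[n --> \oo] --> - ln g.
Proof.
apply: (@squeeze_cvgr _ _ _ _ (fun n => f n * - (n%:R * ln (f n)))
                              (fun n => - (n%:R * ln (f n)))).
- near=> n.
  have f0 : 0 < f n by near: n.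
  rewrite -!mulrN mulrCA !ler_wpM2l//.
    have : ln (1 + (f n - 1)) <= f n - 1 by apply: le_ln1Dx; lra.
    by rewrite [1 + _]addrC subrK; lra.
  have : ln (1 + ((f n)^-1 - 1)) <= (f n)^-1 - 1.
    by apply: le_ln1Dx; rewrite ltrBrDr addNr invr_gt0.
  rewrite [1 + _]addrC subrK lnV// => h.
  have -> : 1 - f n = f n * ((f n)^-1 - 1) by rewrite mulrBr mulfV ?gt_eqF// mulr1.
  by rewrite ler_pM2l.
- rewrite -[X in _ --> X]mul1r; apply: cvgM => //; exact: cvgN.
- exact: cvgN.
Unshelve. all: by end_near. Qed.

(** Induction on [i] by [(i + 1) 'C(r, i + 1) = (r - i) 'C(r, i)]: the new factor [(r - i)(1 - f n)]
    tends to [- c ln g]. *)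
Let cvg_binX r c (i : nat) : 0 < c -> (r n)%:R / n%:R @[n --> \oo] --> c ->
  'C(r n, i)%:R * (1 - f n) ^+ i @[n --> \oo] --> (c * - ln g) ^+ i / i`!%:R.
Proof.
move=> c0 rc; elim: i => [|i IH].
  by under eq_fun do rewrite bin0 mulr1; rewrite expr0 fact0 divr1; exact: cvg_cst.
have h : (r n)%:R / n%:R * (n%:R * (1 - f n)) - i%:R * (1 - f n) @[n --> \oo] -->
    c * - ln g.
  rewrite -[X in _ --> X]subr0; apply: cvgB; first exact: cvgM.
  rewrite -(mulr0 i%:R) -(subrr 1); apply: cvgM; first exact: cvg_cst.
  by apply: cvgB => //; exact: cvg_cst.
have {IH}h : ('C(r n, i)%:R * (1 - f n) ^+ i) *
    ((r n)%:R / n%:R * (n%:R * (1 - f n)) - i%:R * (1 - f n)) / i.+1%:R @[n --> \oo] -->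
    (c * - ln g) ^+ i / i`!%:R * (c * - ln g) / i.+1%:R.
  by apply: cvgM; [exact: cvgM|exact: cvg_cst].
rewrite exprS factS natrM invfM.
rewrite (_ : _ * _ * _ = (c * - ln g) ^+ i / i`!%:R * (c * - ln g) / i.+1%:R); last by ring.
apply: cvg_trans h; apply: near_eq_cvg; near=> n => /=.
have n0 : n%:R != 0 :> R by rewrite pnatr_eq0 -lt0n; near: n; exists 1%N.
have ir : (i <= r n)%N by near: n; exact: ratio_near_ge rc.
have := congr1 (fun x => x%:R : R) (mul_bin_left (r n) i).
rewrite !natrM natrB// => e.
have i0 : i.+1%:R != 0 :> R by rewrite pnatr_eq0.
apply: (mulfI i0); rewrite exprS.
rewrite [RHS]mulrA e; field.
by rewrite nat1r n0 i0.
Unshelve. all: by end_near. Qed.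

(** Termwise limit: the power of [f n] equals [exp((r / n) n ln (f n))] divided by [f n ^+ i], whose
    limits are [g] to the power [c] and 1. *)
Lemma binomial_tail_cvg (k : nat) r c : 0 < c ->
  (r n)%:R / n%:R @[n --> \oo] --> c ->
  \sum_(i < k) 'C(r n, i)%:R * (1 - f n) ^+ i * f n ^+ (r n - i) @[n --> \oo] -->
  expR (c * ln g) * \sum_(i < k) (c * - ln g) ^+ i / i`!%:R.
Proof.
move=> c0 rc; rewrite mulr_sumr; apply: cvg_big => [|i _].
  exact: add_continuous.
rewrite mulrC; apply: cvgM; first exact: cvg_binX.
have h : expR ((r n)%:R / n%:R * (n%:R * ln (f n))) / f n ^+ i @[n --> \oo] -->
    expR (c * ln g).
  rewrite -[X in _ --> X]divr1; apply: cvgM.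
    by apply: continuous_cvg; [exact: continuous_expR|exact: cvgM].
  apply: cvgV; first exact: oner_neq0.
  by rewrite -(expr1n _ i); exact: (cvg_comp _ _ cvg_f1 (@exprn_continuous R i 1)).
apply: cvg_trans h; apply: near_eq_cvg; near=> n.
have n0 : n%:R != 0 :> R by rewrite pnatr_eq0 -lt0n; near: n; exists 1%N.
have f0 : 0 < f n by near: n.
have ir : (i <= r n)%N by near: n; exact: ratio_near_ge rc.
rewrite mulrA mulfVK// expRM_natl lnK// exprB//.
by rewrite unitfE gt_eqF.
Unshelve. all: by end_near. Qed.

End limits.
End poisson_limit.

(** * From deterministic to random sample sizes *)

Section random_index.
Context {d : measure_display} {T : measurableType d} {R : realType}.
Variables (P : probability T R) (X : nat -> {RV P >-> R}) (F : R -> R).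
Hypothesis hX : iid_with_df F X.

Lemma iid_df_bounds (x : R) : 0 <= F x <= 1.
Proof.
have [_ cdfX] := hX.
by rewrite -!lee_fin -(cdfX 0%N) cdf_ge0 cdf_le1.
Qed.

(** The endpoints are rounded to naturals because they serve themselves as sample sizes in the
    squeeze. *)
Definition index_window (e : R) (n : nat) : set nat :=
  [set r | (Num.truncn ((1 - e) * n%:R) <= r <= Num.truncn ((1 + e) * n%:R))%N].

(* Truncation makes the sets monotone in [N]: no independence between [N] and
   [X] is needed. *)
Lemma kth_largest_df_bounds (N : {RV P >-> nat}) (W : set nat) (l u k : nat) (y : R) :
  W `<=` [set r | (l <= r <= u)%N] -> (0 < k <= l)%N ->
  (P (few_exceedances X k u y) <=
     kth_largest_df X N k y + P (~` (N @^-1` W)))%E /\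
  (kth_largest_df X N k y <=
     P (few_exceedances X k l y) + P (~` (N @^-1` W)))%E.
Proof.
move=> Wlu /andP[k0 kl]; rewrite /kth_largest_df.
have mW : measurable (~` (N @^-1` W)).
  by apply: measurableC; apply: (measurable_funPTI N).
have mK := measurable_kth_largest_event X N k y.
have mE r := measurable_few_exceedances X k r y.
have EK r : (k <= r)%N -> few_exceedances X k r y =
    [set t | order_statistic X (r - k + 1) r t <= y].
  move=> kr; rewrite order_statistic_le; last by lia.
  by congr few_exceedances; lia.
(* Both bounds come from set inclusions: on the window the counts are compared by monotonicity, and
   every other point falls into the complement, which is the error term. *)
split; apply: le_trans (measureU2 _ _ _) => //; apply: le_measure;
  rewrite ?inE//; try exact: measurableU.
- move=> t uE; have [Wt|] := pselect (W (N t)); last by right.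
  left => /=; have /= /andP[lN Nu] := Wlu _ Wt.
  have : few_exceedances X k (N t) y t by exact: few_exceedances_anti uE.
  by rewrite EK// (leq_trans kl).
- move=> t /= Kt; have [Wt|] := pselect (W (N t)); last by right.
  left; have /= /andP[lN Nu] := Wlu _ Wt.
  have : few_exceedances X k (N t) y t by rewrite EK// (leq_trans kl).
  exact: few_exceedances_anti.
Qed.

(** [H c] is the limit for samples of size about [c n]. The tolerance is split in thirds: moving [c]
    from 1 to [1 - e] or [1 + e], approximating [H] by binomial tails, and leaving the window. *)
Lemma kth_largest_df_cvg (N : nat -> {RV P >-> nat}) (y : nat -> R) (g : R) (k : nat) :
  0 < g -> F (y n) ^+ n @[n --> \oo] --> g ->
  (forall e : R, 0 < e < 1 ->
    P (N n @^-1` index_window e n) @[n --> \oo] --> 1%E) ->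
  (0 < k)%N ->
  kth_largest_df X (N n) k (y n) @[n --> \oo] -->
  (g * \sum_(i < k) (- ln g) ^+ i / (i`!)%:R)%:E.
Proof.
move=> g0 Fg conc k0.
pose H (c : R) := expR (c * ln g) * \sum_(i < k) (c * - ln g) ^+ i / i`!%:R.
have H1 : H 1 = g * \sum_(i < k) (- ln g) ^+ i / i`!%:R.
  by rewrite /H !mul1r lnK.
have hc (a : R) : c * a @[c --> (1 : R)] --> 1 * a.
  by apply: cvgM; [exact: cvg_id|exact: cvg_cst].
have Hc : H c @[c --> (1 : R)] --> H 1.
  apply: cvgM.
    apply: continuous_cvg; first exact: continuous_expR.
    exact: hc.
  apply: cvg_big => [|i _]; first exact: add_continuous.
  apply: cvgM; last exact: cvg_cst.
  exact: (cvg_comp _ _ (hc _) (@exprn_continuous R i (1 * - ln g))).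
have kf n : kth_largest_df X (N n) k (y n) \is a fin_num.
  by apply: fin_num_measure; exact: measurable_kth_largest_event.
apply: cvg_EFin; first by near=> n.
rewrite -H1; apply/cvgrPdist_le => dl dl0.
have dl3 : 0 < dl / 3 by rewrite divr_gt0.
have [e0 /= e00 e0H] : \forall x \near (1 : R), `|H 1 - H x| < dl / 3.
  by move/cvgrPdist_lt : Hc; exact.
(* The bound [e0 / 2] keeps both levels strictly inside the continuity ball of [H]; [1 / 2] keeps
   [1 - e] positive. *)
pose e := Num.min (e0 / 2) (1 / 2).
have e_gt0 : 0 < e by rewrite lt_min !divr_gt0.
have e_lt1 : e < 1 by rewrite gt_min [X in _ || X](_ : _ = true) ?orbT//; lra.
have e_lt : e < e0 by rewrite gt_min [X in X || _](_ : _ = true)//; lra.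
have Hl : `|H 1 - H (1 - e)| < dl / 3.
  by apply: e0H; rewrite /= opprB addrCA subrr addr0 gtr0_norm.
have Hu : `|H 1 - H (1 + e)| < dl / 3.
  by apply: e0H; rewrite /= opprD addrA subrr add0r normrN gtr0_norm.
have e01 : 0 < e < 1 by rewrite e_gt0.
have le0 : 0 < 1 - e by rewrite subr_gt0.
have ue0 : 0 < 1 + e by rewrite addr_gt0.
have lr := truncn_ratio_cvg (ltW le0).
have ur := truncn_ratio_cvg (ltW ue0).
have Fb n := iid_df_bounds (y n).
have lc := @binomial_tail_cvg R _ g Fb g0 Fg k _ _ le0 lr.
have uc := @binomial_tail_cvg R _ g Fb g0 Fg k _ _ ue0 ur.
have [_ wc] := (fine_cvgP _ _).1 (conc e e01).
near=> n.
have kl : (k <= Num.truncn ((1 - e) * n%:R))%N.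
  by near: n; exact: (ratio_near_ge _ le0).
have := @kth_largest_df_bounds (N n) (index_window e n) _ _ k (y n) (fun _ h => h).
rewrite k0 kl => /(_ isT).
rewrite probability_setC; last exact: (measurable_funPTI (N n)).
rewrite !(prob_few_exceedances hX) -(fineK (kf n)).
have Wf : P (N n @^-1` index_window e n) \is a fin_num.
  by apply: fin_num_measure; exact: (measurable_funPTI (N n)).
rewrite -(fineK Wf) -EFinB -!EFinD !lee_fin => -[h1 h2].
have w3 : 1 - dl / 3 < fine (P (N n @^-1` index_window e n)).
  by near: n; apply: (cvgr_gt 1) => //; rewrite ltrBlDr ltrDl.
have l3 : `|H (1 - e) - \sum_(i < k) 'C(Num.truncn ((1 - e) * n%:R), i)%:R *
    (1 - F (y n)) ^+ i * F (y n) ^+ (Num.truncn ((1 - e) * n%:R) - i)| < dl / 3.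
  by near: n; move/cvgrPdist_lt : lc; apply.
have u3 : `|H (1 + e) - \sum_(i < k) 'C(Num.truncn ((1 + e) * n%:R), i)%:R *
    (1 - F (y n)) ^+ i * F (y n) ^+ (Num.truncn ((1 + e) * n%:R) - i)| < dl / 3.
  by near: n; move/cvgrPdist_lt : uc; apply.
move: Hl Hu l3 u3; rewrite ler_norml !ltr_norml.
move=> /andP[a1 a2] /andP[a3 a4] /andP[a5 a6] /andP[a7 a8].
by apply/andP; split; rewrite /comp; lra.
Unshelve. all: by end_near. Qed.

End random_index.

(** * Concentration of the index by exponential moments *)

(** Once [u n] is below [l / 2], the geometric sequence of ratio [exp(l / 2) < 1] dominates. *)
Lemma cvgn_expR_mul (R : realType) (u : nat -> R) (l : R) : l < 0 ->
  u n @[n --> \oo] --> l -> expR (n%:R * u n) @[n --> \oo] --> (0 : R).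
Proof.
move=> l0 ul; have l2 : l < l / 2 by rewrite ltr_pdivlMr//; lra.
have : (fun n => expR (l / 2) ^+ n) @ \oo --> (0 : R).
  by apply: cvg_expr; rewrite ger0_norm ?expR_ge0// expR_lt1; lra.
apply: (squeeze_cvgr _ (cvg_cst 0)); near=> n.
rewrite expR_ge0 -expRM_natl ler_expR ler_wpM2l// ltW//.
by near: n; exact: (cvgr_lt l).
Unshelve. all: by end_near. Qed.

(** Strict convexity of the exponential at [- ln c] gives [1 - ln c < 1 / c]. The result makes the
    Chernoff exponent [c - 1 - c ln c] negative on either side of 1. *)
Lemma lt_subr1_mul_ln (R : realType) (c : R) : 0 < c -> c != 1 -> c - 1 < c * ln c.
Proof.
move=> c0 c1; have : 1 + - ln c < expR (- ln c).
  by apply: expR_gt1Dx; rewrite oppr_eq0 ln_eq0.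
by rewrite expRN lnK// -(ltr_pM2l c0) mulfV ?gt_eqF// mulrDr mulr1 mulrN; lra.
Qed.

Section concentration.
Context {d : measure_display} {T : measurableType d} {R : realType}.
Variables (P : probability T R) (N : nat -> {RV P >-> nat}).

Lemma index_window_cvg (w : nat -> R) (e : R) :
  w n @[n --> \oo] --> (1 : R) ->
  (\forall n \near \oo, ((w n)%:E <= P (N n @^-1` index_window e n))%E) ->
  P (N n @^-1` index_window e n) @[n --> \oo] --> 1%E.
Proof.
move=> w1 wP; apply: (@squeeze_cvge _ _ _ _ (EFin \o w) _ (fun=> 1%E)).
- near=> n; rewrite probability_le1 ?andbT; first by near: n.
  exact: (measurable_funPTI (N n)).
- by apply: cvg_EFin; [near=> n|exact: w1].
- exact: cvg_cst.
Unshelve. all: by end_near. Qed.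

(** Common frame for the binomial and Poisson laws: [w n j] stands for the mass at [m + j], and
    [w_mgf] compares its generating function with that of a Poisson law of mean [mu n]. Since the
    weights sum to 1, the lower bound [w_le] on the atoms is enough. *)
Variables (m : nat) (w : nat -> nat -> R) (mu : nat -> R).
Hypothesis w_ge0 : forall n j, (0 < n)%N -> 0 <= w n j.
Hypothesis w_le : forall n j, (0 < n)%N ->
  ((w n j)%:E <= P (N n @^-1` [set (m + j)%N]))%E.
Hypothesis w_sum : forall n, (0 < n)%N -> series (w n) K @[K --> \oo] --> (1 : R).
Hypothesis w_mgf : forall n s K, (0 < n)%N -> 0 < s ->
  \sum_(0 <= j < K) w n j * s ^+ j <= expR (mu n * (s - 1)).
Hypothesis mu_cvg : mu n / n%:R @[n --> \oo] --> (1 : R).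

(** This is [c] to the real power [m - c n], so that [c ^+ j] times it is [c] to the power
    [m + j - c n]. *)
Let tail (c : R) (n : nat) : R := expR (- (c * n%:R * ln c)) * c ^+ m.

(** The sign condition on the product covers both tails at once: [m + j] below [c n] with [c < 1],
    or above it with [c > 1]. *)
Let tail_ge1 (c : R) (n j : nat) : 0 < c ->
  0 <= ((m + j)%:R - c * n%:R) * ln c -> 1 <= c ^+ j * tail c n.
Proof.
move=> c0 h; rewrite mulrC -mulrA -exprD -[X in _ * X ^+ _]lnK// -expRM_natl -expRD.
by rewrite -[leLHS]expR0 ler_expR addrC -mulrBl.
Qed.

(** The exponent is [n] times a sequence with the negative limit [c - 1 - c ln c]; the constant
    factor [c ^+ m] due to the shift is harmless. *)
Let tail_cvg (c : R) : 0 < c -> c != 1 ->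
  expR (mu n * (c - 1)) * tail c n @[n --> \oo] --> (0 : R).
Proof.
move=> c0 c1.
have h : expR (n%:R * (mu n / n%:R * (c - 1) - c * ln c)) * c ^+ m @[n --> \oo] -->
    (0 : R).
  rewrite -(mul0r (c ^+ m)); apply: cvgM; last exact: cvg_cst.
  apply: (@cvgn_expR_mul _ _ (1 * (c - 1) - c * ln c)).
    by rewrite mul1r subr_lt0; exact: lt_subr1_mul_ln.
  by apply: cvgB; [apply: cvgM => //; exact: cvg_cst|exact: cvg_cst].
apply: cvg_trans h; apply: near_eq_cvg; near=> n.
have n0 : n%:R != 0 :> R by rewrite pnatr_eq0 -lt0n; near: n; exists 1%N.
rewrite /tail mulrA -expRD; congr (expR _ * _).
by field.
Unshelve. all: by end_near. Qed.

Let window_sum_le (e : R) (n K : nat) : (0 < n)%N ->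
  \sum_(0 <= j < K | `[< index_window e n (m + j)%N >]) w n j <=
  fine (P (N n @^-1` index_window e n)).
Proof.
move=> n0; have mN A : measurable (N n @^-1` A) by exact: (measurable_funPTI (N n)).
rewrite -lee_fin fineK; last exact: fin_num_measure.
rewrite big_mkord -sumEFin.
apply: (@le_trans _ _ (\sum_(j < K | `[< index_window e n (m + j)%N >])
    P (N n @^-1` [set (m + j)%N]))%E).
  by apply: lee_sum => j _; exact: w_le.
rewrite -(@measure_bigsetU_ord_cond _ _ _ _ _ _ (fun j => N n @^-1` [set (m + j)%N])).
- apply: le_measure; rewrite ?inE//.
    by apply: bigsetU_measurable => j _.
  apply: (big_ind (fun A => A `<=` N n @^-1` index_window e n)).
  + exact: sub0set.
  + by move=> A B AW BW; rewrite subUset.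
  + by move=> j /asboolP jW t /= ->.
- by move=> j _.
- move=> i j _ _ [t [/= -> /addnI ij]]; exact: val_inj.
Qed.

(** Markov's argument on partial sums: a weight outside the window is multiplied by a factor at
    least 1 from the tail on its side, the other tail being merely nonnegative. Then [w_mgf] bounds
    both tail sums, and letting [K] grow turns the total weight into 1. *)
Let window_ge (e : R) (n : nat) : 0 < e < 1 -> (0 < n)%N ->
  1 - (expR (mu n * ((1 - e) - 1)) * tail (1 - e) n +
       expR (mu n * ((1 + e) - 1)) * tail (1 + e) n) <=
  fine (P (N n @^-1` index_window e n)).
Proof.
move=> /andP[e0 e1] n0.
have l0 : 0 < 1 - e by rewrite subr_gt0.
have u0 : 0 < 1 + e by rewrite addr_gt0.
have tail0 c : 0 < c -> 0 <= tail c n.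
  by move=> c0; rewrite mulr_ge0 ?expR_ge0// exprn_ge0// ltW.
rewrite lerBlDr; apply: cvgr_to_le (w_sum n0) _.
near=> K; rewrite seriesEnat /=.
apply: (@le_trans _ _ (\sum_(0 <= j < K)
   ((if `[< index_window e n (m + j)%N >] then w n j else 0) +
    (w n j * (1 - e) ^+ j * tail (1 - e) n + w n j * (1 + e) ^+ j * tail (1 + e) n)))).
  apply: ler_sum => j _.
  have wj := w_ge0 j n0.
  have p c : 0 < c -> 0 <= w n j * c ^+ j * tail c n.
    by move=> c0; rewrite !mulr_ge0 ?tail0// exprn_ge0// ltW.
  have pl := p _ l0; have pu := p _ u0.
  case: asboolP => [_|/negP]; first by rewrite lerDl addr_ge0.
  rewrite add0r negb_and -!ltnNge => /orP[jl|uj].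
    apply: (@le_trans _ _ (w n j * (1 - e) ^+ j * tail (1 - e) n)); last by rewrite lerDl.
    rewrite -mulrA ler_peMr// tail_ge1// mulr_le0//.
      rewrite subr_le0.
      have /andP[h _] := @truncn_itv _ ((1 - e) * n%:R) (mulr_ge0 (ltW l0) (ler0n _ _)).
      by apply: le_trans h; rewrite ler_nat ltnW.
    by rewrite -ln1 ler_ln ?posrE//; lra.
  apply: (@le_trans _ _ (w n j * (1 + e) ^+ j * tail (1 + e) n)); last by rewrite lerDr.
  rewrite -mulrA ler_peMr// tail_ge1// mulr_ge0//.
    rewrite subr_ge0.
    (* Exceeding the truncation means reaching at least its successor, which is above
       [(1 + e) n]. *)
    by apply: ltW; apply: lt_le_trans (truncnS_gt _) _; rewrite ler_nat.
  by rewrite ln_ge0//; lra.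
rewrite !big_split /= -big_mkcond -!mulr_suml lerD//; first exact: window_sum_le.
by rewrite lerD// ler_wpM2r ?tail0// w_mgf.
Unshelve. all: by end_near. Qed.

(* Chernoff bounds at the levels [c = 1 - e] and [c = 1 + e], with the parameter
   [s = c] that minimises [n (s - 1) - c n ln s]. *)
Lemma shifted_concentration (e : R) : 0 < e < 1 ->
  P (N n @^-1` index_window e n) @[n --> \oo] --> 1%E.
Proof.
move=> e01; have /andP[e0 e1] := e01.
apply: (@index_window_cvg (fun n =>
  1 - (expR (mu n * ((1 - e) - 1)) * tail (1 - e) n +
       expR (mu n * ((1 + e) - 1)) * tail (1 + e) n))).
  rewrite -[X in _ --> X]subr0 -(addr0 0); apply: cvgB; first exact: cvg_cst.
  by apply: cvgD; apply: tail_cvg; rewrite ?subr_gt0 ?addr_gt0//; apply/eqP; lra.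
near=> n; have n0 : (0 < n)%N by near: n; exists 1%N.
rewrite -[leRHS]fineK ?lee_fin ?window_ge//.
by apply: fin_num_measure; exact: (measurable_funPTI (N n)).
Unshelve. all: by end_near. Qed.

End concentration.

(** * The three index laws *)

Lemma binomial_sum (R : comRingType) (n K : nat) (x q : R) : (n < K)%N ->
  \sum_(0 <= j < K) 'C(n, j)%:R * x ^+ j * q ^+ (n - j) = (q + x) ^+ n.
Proof.
move=> nK; rewrite exprDn -(big_mkord xpredT (fun j => q ^+ (n - j) * x ^+ j *+ 'C(n, j))).
rewrite (big_cat_nat _ nK)//= [X in _ + X]big_nat_cond [X in _ + X]big1 ?addr0; last first.
  by move=> j; rewrite andbT => /andP[nj _]; rewrite bin_small// !mul0r.
by apply: eq_bigr => j _; rewrite -mulr_natl; ring.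
Qed.

Section index_laws.
Context {d : measure_display} {T : measurableType d} {R : realType}.
Variables (P : probability T R) (N : nat -> {RV P >-> nat}).

(** With [mu n = n p n], the generating function is [(1 + p (s - 1)) ^+ n], at most
    [exp(n p (s - 1))] by [1 + t <= exp t]. *)
Lemma shifted_binomial_concentration (m : nat) (p : nat -> R) (e : R) :
  (forall n, (0 < n)%N -> 0 <= p n <= 1) ->
  p n @[n --> \oo] --> (1 : R) ->
  (forall n r, (0 < n)%N -> (m <= r <= m + n)%N ->
    P (N n @^-1` [set r]) =
    (('C(n, r - m))%:R * p n ^+ (r - m) * (1 - p n) ^+ (m + n - r))%:E) ->
  0 < e < 1 -> P (N n @^-1` index_window e n) @[n --> \oo] --> 1%E.
Proof.
move=> p01 p1 PN.
pose w n j : R := 'C(n, j)%:R * p n ^+ j * (1 - p n) ^+ (n - j).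
have w_ge0 n j : (0 < n)%N -> 0 <= w n j.
  by move=> /p01/andP[p0 p_le1]; rewrite /w !mulr_ge0 ?exprn_ge0// subr_ge0.
apply: (@shifted_concentration _ _ _ _ _ m w (fun n => n%:R * p n)) => //.
- move=> n j n0; have [jn|nj] := leqP j n.
    by rewrite PN ?leq_addr ?leq_add2l// addKn subnDl.
  by rewrite /w bin_small// !mul0r measure_ge0.
- move=> n n0; apply: cvg_near_cst; near=> K; rewrite seriesEnat /=.
  rewrite binomial_sum ?subrK ?expr1n//.
  by near: K; exact: nbhs_infty_gt.
- move=> n s K n0 s0; have /andP[p0 p_le1] := p01 n n0.
  (* Enlarging the range past [n] captures the whole support, so the binomial theorem applies. *)
  apply: (@le_trans _ _ (\sum_(0 <= j < K + n.+1) w n j * s ^+ j)).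
    rewrite [leRHS](@big_cat_nat _ _ _ K)//= ?leq_addr// lerDl.
    by apply: sumr_ge0 => j _; rewrite mulr_ge0 ?w_ge0// exprn_ge0// ltW.
  rewrite (eq_bigr (fun j => 'C(n, j)%:R * (p n * s) ^+ j * (1 - p n) ^+ (n - j))); last first.
    by move=> j _; rewrite /w exprMn; ring.
  rewrite binomial_sum ?ltn_addl// -mulrA expRM_natl lerXn2r ?nnegrE ?expR_ge0//.
    by rewrite addr_ge0 ?subr_ge0// mulr_ge0// ltW.
  by rewrite (le_trans _ (expR_ge1Dx _))//; lra.
- apply: cvg_trans p1; apply: near_eq_cvg; near=> n.
  rewrite /= [_ * p n]mulrC mulfK// pnatr_eq0 -lt0n.
  by near: n; exists 1%N.
Unshelve. all: by end_near. Qed.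

(** Here [mu n] is [lambda n] and the generating function is exactly [exp(lambda (s - 1))]; the
    partial sums of the exponential series stay below it. *)
Lemma shifted_poisson_concentration (m : nat) (lambda : nat -> R) (e : R) :
  (forall n, (0 < n)%N -> 0 < lambda n) ->
  lambda n / n%:R @[n --> \oo] --> (1 : R) ->
  (forall n r, (0 < n)%N -> (m <= r)%N ->
    P (N n @^-1` [set r]) =
    (expR (- lambda n) * lambda n ^+ (r - m) / ((r - m)`!)%:R)%:E) ->
  0 < e < 1 -> P (N n @^-1` index_window e n) @[n --> \oo] --> 1%E.
Proof.
move=> l0 l1 PN.
pose w n j : R := expR (- lambda n) * lambda n ^+ j / j`!%:R.
apply: (@shifted_concentration _ _ _ _ _ m w lambda) => //.
- by move=> n j n0; rewrite /w divr_ge0// mulr_ge0 ?expR_ge0// exprn_ge0// ltW// l0.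
- by move=> n j n0; rewrite PN ?leq_addr// addKn.
- move=> n n0.
  have -> : series (w n) = (fun K => expR (- lambda n) * series (exp_coeff (lambda n)) K).
    apply/funext => K; rewrite !seriesEnat /= mulr_sumr.
    by apply: eq_bigr => j _; rewrite /w /exp_coeff /= mulrA.
  rewrite -(expRxMexpNx_1 (lambda n)) mulrC; apply: cvgM; first exact: cvg_cst.
  exact: is_cvg_series_exp_coeff.
- move=> n s K n0 s0.
  rewrite (eq_bigr (fun j => expR (- lambda n) * exp_coeff (lambda n * s) j)); last first.
    by move=> j _; rewrite /w /exp_coeff /= exprMn; ring.
  rewrite -mulr_sumr mulrBr mulr1 addrC expRD ler_wpM2l ?expR_ge0//.
  rewrite -[leLHS]/(series (exp_coeff (lambda n * s)) K).
  apply: nondecreasing_cvgn_le; last exact: is_cvg_series_exp_coeff.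
  apply: nondecreasing_series => j _ _.
  by rewrite /exp_coeff /= divr_ge0// exprn_ge0// mulr_ge0// ltW// l0.
Unshelve. all: by end_near. Qed.

(* The first atom [n + 1] already carries asymptotically all the mass. *)
Lemma shifted_logarithmic_concentration (theta : nat -> R) (e : R) :
  theta n / (- ln (1 - theta n)) @[n --> \oo] --> (1 : R) ->
  (forall n r, (0 < n)%N -> (n + 1 <= r)%N ->
    P (N n @^-1` [set r]) =
    (1 / (- ln (1 - theta n)) * (theta n ^+ (r - n) / (r - n)%:R))%:E) ->
  0 < e < 1 -> P (N n @^-1` index_window e n) @[n --> \oo] --> 1%E.
Proof.
move=> t1 PN /andP[e0 e1]; apply: index_window_cvg t1 _; near=> n.
have n0 : (0 < n)%N by near: n; exists 1%N.
have -> : (theta n / - ln (1 - theta n))%:E = P (N n @^-1` [set (n + 1)%N]).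
  by rewrite PN// addKn expr1 divr1 mulrC mul1r.
apply: le_measure; rewrite ?inE//; try exact: (measurable_funPTI (N n)).
move=> t /= ->; apply/andP; split.
  rewrite -(ler_nat R); apply: (@le_trans _ _ ((1 - e) * n%:R)).
    by rewrite truncn_le mulr_ge0// subr_ge0 ltW.
  apply: (@le_trans _ _ n%:R); last by rewrite ler_nat leq_addr.
  by rewrite ler_piMl//; lra.
(* The upper endpoint asks for [n + 1 <= (1 + e) n], that is, [n] at least [1 / e]. *)
rewrite truncn_ge_nat; last by rewrite mulr_ge0// addr_ge0// ltW.
rewrite natrD mulrDl mul1r lerD2l -ler_pdivrMl// mulr1.
by near: n; exact: nbhs_infty_ger.
Unshelve. all: by end_near. Qed.

End index_laws.

Theorem theorem4p1 (R : realType) (d : measure_display) (T : measurableType d)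
  (P : probability T R)
  (G : R -> R) (hG : max_stable G)
  (F : cumulativeBounded (0 : R) (1 : R))
  (a b : nat -> R) (ha : forall n, (0 < n)%N -> 0 < a n)
  (hF : forall x : R, (F (a n * x + b n)) ^+ n @[n --> \oo] --> G x)
  (X : nat -> {RV P >-> R}) (hX : iid_with_df F X)
  (N : nat -> {RV P >-> nat})
  (hN : forall n, (0 < n)%N -> independent_of_sequence (N n) X) :
  (* (a) *)
  (forall (m : nat) (p : nat -> R), (1 <= m)%N ->
    (forall n, (0 < n)%N -> 0 <= p n <= 1) ->
    p n @[n --> \oo] --> (1 : R) ->
    (forall n r, (0 < n)%N -> (m <= r <= m + n)%N ->
      P (N n @^-1` [set r]) =
      (('C(n, r - m))%:R * p n ^+ (r - m) * (1 - p n) ^+ (m + n - r))%:E) ->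
    forall (k : nat) (x : R), (1 <= k <= m)%N -> 0 < G x ->
      kth_largest_df X (N n) k (a n * x + b n) @[n --> \oo] -->
      (G x * \sum_(i < k) (- ln (G x)) ^+ i / (i`!)%:R)%:E) /\
  (* (b) *)
  (forall (m : nat) (lambda : nat -> R), (1 <= m)%N ->
    (forall n, (0 < n)%N -> 0 < lambda n) ->
    lambda n / n%:R @[n --> \oo] --> (1 : R) ->
    (forall n r, (0 < n)%N -> (m <= r)%N ->
      P (N n @^-1` [set r]) =
      (expR (- lambda n) * lambda n ^+ (r - m) / ((r - m)`!)%:R)%:E) ->
    forall (k : nat) (x : R), (1 <= k <= m)%N -> 0 < G x ->
      kth_largest_df X (N n) k (a n * x + b n) @[n --> \oo] -->
      (G x * \sum_(i < k) (- ln (G x)) ^+ i / (i`!)%:R)%:E) /\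
  (* (c) *)
  (forall theta : nat -> R,
    (forall n, (0 < n)%N -> 0 < theta n < 1) ->
    theta n / (- ln (1 - theta n)) @[n --> \oo] --> (1 : R) ->
    (forall n r, (0 < n)%N -> (n + 1 <= r)%N ->
      P (N n @^-1` [set r]) =
      (1 / (- ln (1 - theta n)) * (theta n ^+ (r - n) / (r - n)%:R))%:E) ->
    forall (k : nat) (x : R), (1 <= k)%N -> 0 < G x ->
      kth_largest_df X (N n) k (a n * x + b n) @[n --> \oo] -->
      (G x * \sum_(i < k) (- ln (G x)) ^+ i / (i`!)%:R)%:E).
Proof.
(* The three parts share this limit and differ only in how concentration of the index is
   obtained. *)
have lim k x : (1 <= k)%N -> 0 < G x ->
    (forall e : R, 0 < e < 1 ->
      P (N n @^-1` index_window e n) @[n --> \oo] --> 1%E) ->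
    kth_largest_df X (N n) k (a n * x + b n) @[n --> \oo] -->
    (G x * \sum_(i < k) (- ln (G x)) ^+ i / (i`!)%:R)%:E.
  by move=> k0 Gx conc; exact: (kth_largest_df_cvg hX Gx (hF x) conc k0).
split; [|split].
- move=> m p _ p01 p1 PN k x /andP[k0 _] Gx; apply: lim => // e.
  exact: shifted_binomial_concentration p01 p1 PN.
- move=> m lambda _ l0 l1 PN k x /andP[k0 _] Gx; apply: lim => // e.
  exact: shifted_poisson_concentration l0 l1 PN.
- move=> theta _ t1 PN k x k0 Gx; apply: lim => // e.
  exact: shifted_logarithmic_concentration t1 PN.
Qed.
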